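(* Let $k$ be a field, $A$ a nonzero associative $k$-algebra with identity, and let $R$ be an entire atomistic subsemiring of $S(A)$, with set of atoms $\mathcal{Q}(R)$, focus $\varpi_R$ and focal subspace $F(R)$. Let $[0,F(R)]=\{E\in R\mid E\subset F(R)\}$. Then: (1) $F(R)$ is a unital subalgebra of $A$. (2) The sublattice $[0,F(R)]\subset R$ is an entire atomistic subsemiring of $S(F(R))$, and $\varpi_R\subset\mathcal{Q}([0,F(R)])$. (3) If $R$ is weakly reproducible and has finite length, then $\mathcal{Q}([0,F(R)])=\varpi_R$. (4) If $R$ is weakly reproducible (resp. reproducible) of finite length, then the same holds for $[0,F(R)]$.
   Context: $S(A)$ is the lattice of $k$-subspaces of $A$, with sum, intersection, and product $EF=\mathrm{span}\{ef\mid e\in E,f\in F\}$; the subspace $k1_A$ is also written $k$. An atomistic subsemiring of $S(A)$ is a subset $R\subset S(A)$ containing $\{0\}$ and $k1_A$, closed under arbitrary sums, arbitrary intersections (of nonempty families) and finite products (the maximum of $R$ need not be $A$), such that every nonzero element of $R$ is a (possibly infinite) sum of atoms of $R$, an atom being a minimal nonzero element of $R$. $\mathcal{Q}(R)$ is the set of atoms; it contains $k=k1_A$. $R$ is entire if $EF=0$ with $E,F\in R$ implies $E=0$ or $F=0$. $R$ has finite length if there is a finite bound on the lengths of chains in the lattice $R$. For $X,Y\in\mathcal{Q}(R)$, $X\circ Y=\{Z\in\mathcal{Q}(R)\mid Z\subset XY\}$; for subsets, $\circ$ is extended by taking unions. The relation $\zeta$ on $\mathcal{Q}(R)$: $X\,\zeta\,Y$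 iff there exist $n\ge1$ and $Z_1,\dots,Z_n\in\mathcal{Q}(R)$ with $X,Y\subset Z_1Z_2\cdots Z_n$; $\zeta^*$ is its transitive closure, an equivalence relation. The focus $\varpi_R\subset\mathcal{Q}(R)$ is the $\zeta^*$-equivalence class of $k$, and $F(R)=\sum\{X\mid X\in\varpi_R\}\in R$. An entire atomistic subsemiring $R$ is weakly reproducible if for every $X\in\mathcal{Q}(R)$ there exist $Y,Z\in\mathcal{Q}(R)$ with $k\in (X\circ Y)\cap (Z\circ X)$; it is reproducible if $\mathcal{Q}(R)\circ X=\mathcal{Q}(R)=X\circ\mathcal{Q}(R)$ for all $X\in\mathcal{Q}(R)$. *)

(* Defs.v *)
From HB Require Import structures.
From Stdlib Require Import Relations.
From mathcomp Require Import all_boot all_order all_algebra.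
From mathcomp Require Import all_classical.

Set Implicit Arguments.
Unset Strict Implicit.
Unset Printing Implicit Defensive.

Import GRing.Theory.
Local Open Scope classical_set_scope.
Local Open Scope ring_scope.
Local Open Scope card_scope.

(* Subspaces of A, which may be infinite-dimensional, are sets that are closed
   under the module operations; a subset of S(A) is a set of such sets. *)
Section Subspaces.
Variables (k : fieldType) (A : algType k).
Implicit Types (E F X Y Z : set A) (R S T : set (set A)).

Definition is_subspace E : Prop := submod_closed [in E].

Definition span (G : set A) : set A := smallest is_subspace G.

Definition sum_family S : set A := span (\bigcup_(E in S) E).

Definition mul_subspace E F : set A :=
  span [set x | exists e f, [/\ E e, F f & x = e * f]].

Definition k1 : set A := range (fun c : k => c%:A).

Definition is_atom R X : Prop :=
  [/\ R X, X <> [set 0] &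
      forall E, R E -> E `<=` X -> E <> [set 0] -> E = X].

Definition atoms R : set (set A) := [set X | is_atom R X].

Record atomistic_subsemiring R : Prop := AtomisticSubsemiring {
  assr_subspace : forall E, R E -> is_subspace E;
  assr_zero : R [set 0];
  assr_one : R k1;
  assr_sum : forall S, S `<=` R -> R (sum_family S);
  assr_cap : forall S, S `<=` R -> S !=set0 -> R (\bigcap_(E in S) E);
  assr_mul : forall E F, R E -> R F -> R (mul_subspace E F);
  assr_atomistic : forall E, R E -> E <> [set 0] ->
    exists2 S, S `<=` atoms R & E = sum_family S }.

Definition entire R : Prop :=
  forall E F, R E -> R F -> mul_subspace E F = [set 0] ->
    E = [set 0] \/ F = [set 0].

Definition finite_length R : Prop :=
  exists n : nat, forall C : set (set A),
    C `<=` R -> total_on C (fun E F => E `<=` F) -> C #<= `I_n.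

Definition circ R X Y : set (set A) :=
  [set Z | atoms R Z /\ Z `<=` mul_subspace X Y].

Definition circ_sets R S T : set (set A) :=
  \bigcup_(X in S) \bigcup_(Y in T) circ R X Y.

(* The product Z1 Z2 ... Zn (n >= 1) is the left fold over Z1 and the list
   [:: Z2; ...; Zn]. *)
Definition zeta R X Y : Prop :=
  [/\ atoms R X, atoms R Y &
      exists (Z1 : set A) (Zs : seq (set A)),
        [/\ forall Z, Z \in Z1 :: Zs -> atoms R Z,
            X `<=` foldl mul_subspace Z1 Zs &
            Y `<=` foldl mul_subspace Z1 Zs]].

Definition zeta_star R : set A -> set A -> Prop :=
  clos_trans (set A) (zeta R).

Definition focus R : set (set A) := [set X | zeta_star R X k1].

Definition focal R : set A := sum_family (focus R).

Definition weakly_reproducible R : Prop :=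
  forall X, atoms R X ->
    exists Y Z, [/\ atoms R Y, atoms R Z & (circ R X Y `&` circ R Z X) k1].

Definition reproducible R : Prop :=
  forall X, atoms R X ->
    circ_sets R (atoms R) [set X] = atoms R /\
    circ_sets R [set X] (atoms R) = atoms R.

Definition below R F : set (set A) := [set E | R E /\ E `<=` F].

Definition is_unital_subalgebra (B : set A) : Prop := subalg_closed [in B].

End Subspaces.

Arguments k1 {k} A.

(* A unital subalgebra B of A, as a k-algebra in its own right; hB occurs in no
   field, but it is what the algebra structure is built from. *)
Record subalgebra (k : fieldType) (A : algType k) (B : set A)
    (hB : is_unital_subalgebra B) := Subalgebra {
  subalgebra_val :> A;
  _ : subalgebra_val \in B }.

Section SubalgebraType.
Variables (k : fieldType) (A : algType k) (B : set A).
Variable hB : is_unital_subalgebra B.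

HB.instance Definition _ := [isSub for @subalgebra_val k A B hB].
HB.instance Definition _ := [Choice of subalgebra hB by <:].
HB.instance Definition _ :=
  GRing.SubChoice_isSubAlgebra.Build k A [in B] (subalgebra hB)
    (GRing.subalg_closed_semi hB).

(* The members of R, which should lie in B, as subsets of B. *)
Definition restrict_to (R : set (set A)) : set (set (subalgebra hB)) :=
  [set (val : subalgebra hB -> A) @^-1` E | E in R].

Lemma subalgebra_val1 : val (1 : subalgebra hB) = 1 :> A.
Proof. by []. Qed.

Lemma subalgebra_valM (x y : subalgebra hB) : val (x * y) = val x * val y :> A.
Proof. by []. Qed.

Lemma subalgebra_valP (a : k) (x y : subalgebra hB) :
  val (a *: x + y) = a *: val x + val y :> A.
Proof. by []. Qed.

End SubalgebraType.

Arguments restrict_to {k A B} hB R.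

(* Main.v *)
From Stdlib Require Import Relations.
Require Import Defs.
From mathcomp Require Import all_boot all_order all_algebra.
From mathcomp Require Import all_classical.

(** Multiplication of atoms is compatible with [zeta_star]: if [X] and [X'] lie
    in one product of atoms [P], then every atom below [X Y] and every atom
    below [X' Y] lie in the product of atoms [P Y]; entirety makes [X' Y]
    nonzero, so that such atoms exist and chains of [zeta] can be followed
    link by link ([zeta_star_mulr]). If [X] is in the focus, the atoms below
    [X Y] are thus equivalent to those below [k Y = Y]. Hence the product of
    two members of the focus is a sum of members of the focus, and the focal
    subspace is a unital subalgebra ([focal_mul]). The members of [R] below a
    subalgebra which belongs to [R] form an atomistic subsemiring
    ([below_atomistic]), with the atoms of [R] that lie in it as atoms.

    Assume finite length. Products of atoms that contain [k] are directed,
    since [P Q] contains both [P] and [Q]; so there is a greatest one, [T]. It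
    lies in the focal subspace, because every atom below it is [zeta]-related to
    [k]. The greatest product absorbs: if [X] is an atom, [Y] is below [T] and
    [k] is below [X Y], then [X T] is again a product of atoms that contains
    [k], whence [X T] and also [X] are below [T]. Under weak reproducibility,
    which supplies one-sided inverses, absorption shows that the atoms below
    [T] are closed under [zeta] ([greatest_zeta]); so [T] contains the focus
    and equals the focal subspace ([focal_greatest]). Any atom below the focal
    subspace therefore lies with [k] in the product [T], so it belongs to the
    focus. Both forms of reproducibility are inherited because a one-sided
    inverse of an atom of the focus is absorbed, and so is any solution [Y] of
    [W <= Y X] with [W] and [X] in the focus: multiplying by an inverse of [W]
    makes the right side contain [k].

    All this takes place inside [A]. The subalgebra as an algebra of its own
    enters only at the end: the direct image along an injective morphism of
    algebras respects spans, products, the unit and the order, so every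
    property in question can be pulled back along it ([pullback]). *)

Set Implicit Arguments.
Unset Strict Implicit.
Unset Printing Implicit Defensive.

Import GRing.Theory.
Local Open Scope classical_set_scope.
Local Open Scope ring_scope.
Local Open Scope card_scope.

(* The plain name would denote the span of a list in a vector space. *)
Local Notation span := Defs.span.

(** * The semiring of subspaces *)

Section SubspaceSemiring.
Variables (k : fieldType) (A : algType k).
Implicit Types (E F G X Y Z P : set A) (S : set (set A)).

Lemma is_subspaceP E :
  is_subspace E <->
  E 0 /\ forall (a : k) u v, E u -> E v -> E (a *: u + v).
Proof.
rewrite /is_subspace /GRing.submod_closed /GRing.linear_closed; split.
- move=> [/set_mem E0 El]; split=> // a u v Eu Ev.
  by apply/set_mem/El; apply/mem_set.
- move=> [E0 El]; split; first exact/mem_set.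
  by move=> a u v /set_mem Eu /set_mem Ev; apply/mem_set/El.
Qed.

Lemma subspace0 E : is_subspace E -> E 0.
Proof. by case/is_subspaceP. Qed.

Lemma subspace_lin E (a : k) u v :
  is_subspace E -> E u -> E v -> E (a *: u + v).
Proof. by case/is_subspaceP=> _; apply. Qed.

Lemma subspaceZ E (a : k) u : is_subspace E -> E u -> E (a *: u).
Proof.
move=> sE Eu; rewrite -[_ *: _]addr0.
by apply: subspace_lin => //; apply: subspace0.
Qed.

Lemma sub0_subspace E : is_subspace E -> [set 0] `<=` E.
Proof. by move=> /subspace0 E0 _ ->. Qed.

Lemma subset0_subspace E : is_subspace E -> E `<=` [set 0] -> E = [set 0].
Proof. by move=> sE E0; apply/seteqP; split=> //; apply: sub0_subspace. Qed.

Lemma span_subspace (U : set A) : is_subspace (span U).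
Proof.
apply/is_subspaceP; split=> [M [sM _]|a u v Uu Uv M [sM UM]].
  exact: subspace0.
by apply: subspace_lin => //; [apply: Uu | apply: Uv].
Qed.

Lemma sub_span (U : set A) : U `<=` span U.
Proof. exact: sub_gen_smallest. Qed.

Lemma span_sub (U : set A) E : is_subspace E -> U `<=` E -> span U `<=` E.
Proof. by move=> sE UE; apply: smallest_sub. Qed.

Lemma sum_sup S E : S E -> E `<=` sum_family S.
Proof. by move=> SE x Ex; apply: sub_span; exists E. Qed.

Lemma sum_sub S E :
  is_subspace E -> (forall X, S X -> X `<=` E) -> sum_family S `<=` E.
Proof. by move=> sE SE; apply: span_sub => // x [X SX]; apply: SE. Qed.

Lemma mul_sup E F e f : E e -> F f -> mul_subspace E F (e * f).
Proof. by move=> Ee Ff; apply: sub_span; exists e, f. Qed.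

Lemma mul_sub E F G : is_subspace G ->
  (forall e f, E e -> F f -> G (e * f)) -> mul_subspace E F `<=` G.
Proof.
by move=> sG EFG; apply: span_sub => // _ [e [f [Ee Ff ->]]]; apply: EFG.
Qed.

Lemma mul_mono E E' F F' : E `<=` E' -> F `<=` F' ->
  mul_subspace E F `<=` mul_subspace E' F'.
Proof.
move=> EE' FF'; apply: mul_sub => [|e f Ee Ff]; first exact: span_subspace.
by apply: mul_sup; [apply: EE' | apply: FF'].
Qed.

(** Being mapped into [E] by multiplication with a fixed element is a linear
    condition, so it can be checked on the generators of a span; this and the
    mirror image below let each factor of a product be treated separately. *)
Lemma mulr_preimage_subspace E (y : A) :
  is_subspace E -> is_subspace [set x | E (x * y)].
Proof.
move=> sE; apply/is_subspaceP; split=> [|a u v] /=.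
  by rewrite mul0r; apply: subspace0.
by rewrite mulrDl -scalerAl; apply: subspace_lin.
Qed.

Lemma mull_preimage_subspace E (y : A) :
  is_subspace E -> is_subspace [set x | E (y * x)].
Proof.
move=> sE; apply/is_subspaceP; split=> [|a u v] /=.
  by rewrite mulr0; apply: subspace0.
by rewrite mulrDr -scalerAr; apply: subspace_lin.
Qed.

Lemma mul_subA E F G :
  mul_subspace E (mul_subspace F G) = mul_subspace (mul_subspace E F) G.
Proof.
apply/seteqP; split; apply: mul_sub; try exact: span_subspace.
- move=> e x Ee.
  apply: (span_sub (mull_preimage_subspace e (span_subspace _))).
  move=> _ [f [g [Ff Gg ->]]] /=; rewrite mulrA.
  by apply: mul_sup => //; apply: mul_sup.
- move=> x g + Gg; move: x.
  apply: (span_sub (mulr_preimage_subspace g (span_subspace _))).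
  move=> _ [e [f [Ee Ff ->]]] /=; rewrite -mulrA.
  by apply: mul_sup => //; apply: mul_sup.
Qed.

Lemma k1_1 : k1 A 1.
Proof. by exists 1; rewrite ?scale1r. Qed.

Lemma k1_subP E : is_subspace E -> k1 A `<=` E <-> E 1.
Proof.
move=> sE; split=> [|E1 _ [c _ <-]]; first by apply; exact: k1_1.
exact: subspaceZ.
Qed.

Lemma mul_k1l E : is_subspace E -> mul_subspace (k1 A) E = E.
Proof.
move=> sE; apply/seteqP; split; last first.
  by move=> x Ex; rewrite -[x]mul1r; apply: mul_sup => //; apply: k1_1.
apply: mul_sub => // _ f [c _ <-] Ef.
by rewrite -scalerAl mul1r; apply: subspaceZ.
Qed.

Lemma mul_k1r E : is_subspace E -> mul_subspace E (k1 A) = E.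
Proof.
move=> sE; apply/seteqP; split; last first.
  by move=> x Ex; rewrite -[x]mulr1; apply: mul_sup => //; apply: k1_1.
apply: mul_sub => // f _ Ef [c _ <-].
by rewrite -scalerAr mulr1; apply: subspaceZ.
Qed.

Lemma sub_mull E F : is_subspace F -> k1 A `<=` E -> F `<=` mul_subspace E F.
Proof.
by move=> sF kE; rewrite -[X in X `<=` _]mul_k1l //; apply: mul_mono.
Qed.

Lemma sub_mulr E F : is_subspace E -> k1 A `<=` F -> E `<=` mul_subspace E F.
Proof.
by move=> sE kF; rewrite -[X in X `<=` _]mul_k1r //; apply: mul_mono.
Qed.

Lemma unital_subalgebra_of_mul E : is_subspace E -> k1 A `<=` E ->
  mul_subspace E E `<=` E -> is_unital_subalgebra E.
Proof.
move=> sE kE EE; split; first by apply/mem_set/kE/k1_1.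
  by case: sE.
suff EM : {in E &, forall u v, u * v \in E} by exact: EM.
by move=> u v /set_mem Eu /set_mem Ev; apply/mem_set/EE; apply: mul_sup.
Qed.

End SubspaceSemiring.

(** * Atoms, products of atoms and the focus *)

Section Focus.
Variables (k : fieldType) (A : algType k) (R : set (set A)).
Hypotheses (hR : atomistic_subsemiring R) (hE : entire R).
Implicit Types (E F G X Y Z P Q T : set A) (S : set (set A)).

Let subR E : R E -> is_subspace E := @assr_subspace _ _ _ hR E.

Lemma atomR X : atoms R X -> R X. Proof. by case. Qed.

(** A nonzero member of [R] below the line [k] contains a nonzero scalar, hence
    the unit. *)
Lemma k1_atom : atoms R (k1 A).
Proof.
split; first exact: assr_one hR.
  move=> k10; have := @k1_1 k A; rewrite k10 => /eqP.
  by rewrite oner_eq0.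
move=> E RE Ek En0; have sE := subR RE.
apply/seteqP; split=> //; apply/(k1_subP sE).
have [x Ex xn0] : exists2 x, E x & x <> 0.
  apply: contra_notP En0 => noE; apply: subset0_subspace => // x Ex.
  by apply: contra_notP noE => xn0; exists x.
have [c _ def_x] := Ek x Ex; have cn0 : c != 0.
  by apply/eqP=> c0; apply: xn0; rewrite -def_x c0 scale0r.
have -> : (1 : A) = c^-1 *: x by rewrite -def_x scalerA mulVf ?scale1r.
exact: subspaceZ.
Qed.

Lemma exists_atom E : R E -> E <> [set 0] -> exists2 X, atoms R X & X `<=` E.
Proof.
move=> RE En0; have [S SR defE] := assr_atomistic hR RE En0.
have [X SX] : S !=set0.
  apply/set0P/eqP=> S0; apply: En0; rewrite defE S0.
  apply: subset0_subspace; first exact: span_subspace.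
  by apply: sum_sub => [|X []]; apply: subR; apply: assr_zero hR.
by exists X; [apply: SR | rewrite defE; apply: sum_sup].
Qed.

(** Everything shown about the atoms below a product passes to the product
    itself through this test. *)
Lemma sub_of_atoms E F : R E -> is_subspace F ->
  (forall X, atoms R X -> X `<=` E -> X `<=` F) -> E `<=` F.
Proof.
move=> RE sF atF; have [->|En0] := pselect (E = [set 0]).
  exact: sub0_subspace.
have [S SR defE] := assr_atomistic hR RE En0.
rewrite defE; apply: sum_sub => // X SX; apply: atF (SR X SX) _.
by rewrite defE; apply: sum_sup.
Qed.

Lemma mul_neq0 E F : R E -> R F -> E <> [set 0] -> F <> [set 0] ->
  mul_subspace E F <> [set 0].
Proof. by move=> RE RF En0 Fn0 /(hE RE RF)[]. Qed.

(** These subspaces are the upper bounds that witness [zeta]. *)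
Definition atom_product P : Prop :=
  exists (Z1 : set A) (Zs : seq (set A)),
    (forall Z, Z \in Z1 :: Zs -> atoms R Z) /\
    P = foldl (@mul_subspace k A) Z1 Zs.

Lemma atom_product1 X : atoms R X -> atom_product X.
Proof. by move=> aX; exists X, [::]; split=> // Z; rewrite inE => /eqP->. Qed.

(** Associativity lets the left-nested products of [zeta] be concatenated. *)
Lemma foldl_mulA X Y (Zs : seq (set A)) :
  foldl (@mul_subspace k A) (mul_subspace X Y) Zs =
  mul_subspace X (foldl (@mul_subspace k A) Y Zs).
Proof. by elim: Zs Y => //= Z Zs IH Y; rewrite -mul_subA IH. Qed.

Lemma atom_productM P Q :
  atom_product P -> atom_product Q -> atom_product (mul_subspace P Q).
Proof.
move=> [X [Xs [aX ->]]] [Y [Ys [aY ->]]].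
exists X, (Xs ++ Y :: Ys); split; last by rewrite foldl_cat /= foldl_mulA.
move=> Z; rewrite -cat_cons mem_cat => /orP[]; [exact: aX | exact: aY].
Qed.

Lemma atom_productR P : atom_product P -> R P.
Proof.
move=> [X [Xs [aX ->]]]; elim: Xs X aX => [|Y Ys IH] X aX /=.
  by apply/atomR/aX; rewrite inE.
rewrite foldl_mulA; apply: (assr_mul hR).
  by apply/atomR/aX; rewrite inE eqxx.
by apply: IH => Z ZY; apply: aX; rewrite inE ZY orbT.
Qed.

Lemma zetaP X Y : zeta R X Y <->
  [/\ atoms R X, atoms R Y &
      exists P, [/\ atom_product P, X `<=` P & Y `<=` P]].
Proof.
split=> -[aX aY]; last first.
  by move=> [_ [[Z [Zs [aZ ->]]] XP YP]]; split=> //; exists Z, Zs.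
move=> [Z [Zs [aZ XP YP]]]; split=> //.
by exists (foldl (@mul_subspace k A) Z Zs); split=> //; exists Z, Zs.
Qed.

Lemma zeta_star_atom X Y : zeta_star R X Y -> atoms R X /\ atoms R Y.
Proof. by elim=> {X Y} [X Y []//|X Y Z _ [aX _] _ [_ aZ]]. Qed.

Lemma focus_atom X : focus R X -> atoms R X.
Proof. by case/zeta_star_atom. Qed.

Lemma k1_focus : focus R (k1 A).
Proof.
apply: t_step; apply/zetaP; split; try exact: k1_atom.
by exists (k1 A); split=> //; apply: atom_product1 k1_atom.
Qed.

(** Each [zeta] step is preserved because the product that contains both of its
    ends, once multiplied by [Y], contains everything below either end times
    [Y]. At an intermediate atom [V] of a chain, entirety provides an atom below
    [V Y] through which the multiplied chain passes. *)
Lemma zeta_star_mulr X X' Y Z Z' : zeta_star R X X' -> atoms R Y ->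
  atoms R Z -> Z `<=` mul_subspace X Y ->
  atoms R Z' -> Z' `<=` mul_subspace X' Y -> zeta_star R Z Z'.
Proof.
move=> XX' aY; elim: XX' Z Z' => {X X'} [X X'|X V X' XV IH1 VX' IH2].
- move=> /zetaP[aX aX' [P [pP XP X'P]]] Z Z' aZ ZXY aZ' ZXY'.
  apply: t_step; apply/zetaP; split=> //; exists (mul_subspace P Y); split.
  + by apply: atom_productM => //; apply: atom_product1.
  + by apply: subset_trans ZXY _; apply: mul_mono.
  + by apply: subset_trans ZXY' _; apply: mul_mono.
- move=> Z Z' aZ ZXY aZ' ZXY'; have [_ aV] := zeta_star_atom XV.
  have [W aW WVY] : exists2 W, atoms R W & W `<=` mul_subspace V Y.
    have [[RV Vn0 _] [RY Yn0 _]] := (aV, aY).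
    by apply: exists_atom; [apply: assr_mul | apply: mul_neq0].
  by exact: t_trans (IH1 _ _ aZ ZXY aW WVY) (IH2 _ _ aW WVY aZ' ZXY').
Qed.

(** The previous lemma with [X' = k], for which [X' Y = Y]. *)
Lemma focus_mul X Y Z : focus R X -> focus R Y ->
  atoms R Z -> Z `<=` mul_subspace X Y -> focus R Z.
Proof.
move=> fX fY aZ ZXY; have aY := focus_atom fY.
apply: t_trans fY; apply: (zeta_star_mulr fX aY aZ ZXY aY).
by rewrite mul_k1l //; apply/subR/atomR.
Qed.

Lemma focalR : R (focal R).
Proof. by apply: (assr_sum hR) => X /focus_atom/atomR. Qed.

Lemma focus_sub_focal X : focus R X -> X `<=` focal R.
Proof. exact: sum_sup. Qed.

Lemma k1_sub_focal : k1 A `<=` focal R.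
Proof. exact: focus_sub_focal k1_focus. Qed.

(** Bilinearity reduces the claim to products of two members of the focus, and
    atomisticity to the atoms below such a product. *)
Lemma focal_mul : mul_subspace (focal R) (focal R) `<=` focal R.
Proof.
have sF := subR focalR.
have XY X Y x y : focus R X -> focus R Y -> X x -> Y y -> focal R (x * y).
  move=> fX fY Xx Yy.
  have [RX RY] := (atomR (focus_atom fX), atomR (focus_atom fY)).
  apply: (sub_of_atoms (assr_mul hR RX RY) sF) (mul_sup Xx Yy) => Z aZ ZXY.
  exact: focus_sub_focal (focus_mul fX fY aZ ZXY).
apply: mul_sub => // x y Fx Fy.
apply: (sum_sub (mulr_preimage_subspace y sF)) Fx => X fX {}x Xx.
by apply: (sum_sub (mull_preimage_subspace x sF)) Fy => Y fY {}y; apply: XY Xx.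
Qed.

(** * Finite length *)

(** Otherwise choosing a strictly larger member again and again would produce
    an infinite chain. *)
Lemma finite_length_maximal S : finite_length R -> S `<=` R -> S !=set0 ->
  exists2 T, S T & forall P, S P -> T `<=` P -> P = T.
Proof.
move=> [n len] SR [P0 SP0]; apply: contrapT => nomax.
have step (P : {E | S E}) : exists Q : {E | S E}, sval P `<` sval Q.
  apply: contra_notP nomax => noQ; exists (sval P); first exact: (svalP P).
  move=> Q SQ PQ; apply: contra_notP noQ => neQ.
  exists (exist _ Q SQ); split=> //= QP; apply: neQ.
  by apply/seteqP.
have [next nextP] := choice step.
pose f i := sval (iter i next (exist _ P0 SP0)).
have f_lt : {homo f : i j / (i < j)%N >-> i `<` j}.
  apply: homo_ltn => [E F G [EF _] [FG nGF]|i]; last exact: nextP.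
  split=> [|GE]; first exact: subset_trans FG.
  by apply: nGF; exact: subset_trans GE EF.
have f_le i j : (i <= j)%N -> f i `<=` f j.
  by rewrite leq_eqVlt => /orP[/eqP->|/f_lt/properW].
have f_inj : injective f.
  have no i j : (i < j)%N -> f i <> f j.
    by move=> /f_lt + ij; rewrite ij => /properxx.
  move=> i j eq_f; case: (ltngtP i j) => // /no; first by case.
  by move=> /(_ (esym eq_f)).
apply: infinite_nat; apply/finite_set_leP; exists n.
have rf : range f #= [set: nat] by apply: inj_card_eq => i j _ _; apply: f_inj.
rewrite -(card_le_eql rf); apply: len.
  by move=> _ [i _ <-]; apply: SR; apply: svalP.
move=> _ _ [i _ <-] [j _ <-].
by case/orP: (leq_total i j) => /f_le; [left | right].
Qed.

(** * Weak reproducibility *)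

Hypotheses (wR : weakly_reproducible R) (lenR : finite_length R).

(** Such a product witnesses that each atom below it is [zeta]-related to
    [k]. *)
Lemma atom_product_sub_focal P :
  atom_product P -> k1 A `<=` P -> P `<=` focal R.
Proof.
move=> pP kP; apply: (sub_of_atoms (atom_productR pP) (subR focalR)) => X aX XP.
apply: focus_sub_focal; apply: t_step; apply/zetaP.
by split; [| exact: k1_atom | exists P].
Qed.

Definition greatest_atom_product T : Prop :=
  [/\ atom_product T, k1 A `<=` T &
      forall P, atom_product P -> k1 A `<=` P -> P `<=` T].

(** A maximal product [T] is greatest: for any other product [P] that contains
    [k], the product [T P] contains [T], hence equals it, and contains [P]. *)
Lemma greatest_atom_product_exists : exists T, greatest_atom_product T.
Proof.
have [| |T [pT kT] maxT] :=
    @finite_length_maximal [set P | atom_product P /\ k1 A `<=` P] lenR.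
- by move=> P [/atom_productR].
- by exists (k1 A); split=> //; apply: atom_product1 k1_atom.
exists T; split=> // P pP kP.
have [sT sP] := (subR (atom_productR pT), subR (atom_productR pP)).
rewrite -(maxT (mul_subspace T P)); first exact: sub_mull.
  split; first exact: atom_productM.
  by apply: (subset_trans kT); apply: sub_mulr.
exact: sub_mulr.
Qed.

(** Absorption: [X T] is a product of atoms, and contains [X Y], hence [k]. *)
Lemma greatest_mull T X Y : greatest_atom_product T -> atoms R X ->
  k1 A `<=` mul_subspace X Y -> Y `<=` T -> mul_subspace X T `<=` T.
Proof.
move=> [pT kT maxT] aX kXY YT.
apply: maxT; first exact: atom_productM (atom_product1 aX) pT.
by apply: (subset_trans kXY); apply: mul_mono.
Qed.

Lemma greatest_factorl T X Y : greatest_atom_product T -> atoms R X ->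
  k1 A `<=` mul_subspace X Y -> Y `<=` T -> X `<=` T.
Proof.
move=> gT aX kXY YT; apply: subset_trans (greatest_mull gT aX kXY YT).
by case: gT => pT kT _; apply: sub_mulr => //; apply/subR/atomR.
Qed.

Lemma greatest_factorr T X Y : greatest_atom_product T -> atoms R Y ->
  k1 A `<=` mul_subspace X Y -> X `<=` T -> Y `<=` T.
Proof.
move=> [pT kT maxT] aY kXY XT; have sY := subR (atomR aY).
apply: subset_trans (sub_mull sY kT) _.
apply: maxT; first exact: atom_productM (atom_product1 aY).
by apply: (subset_trans kXY); apply: mul_mono.
Qed.

(** Let [Z] be a left inverse of [Y] and [W] one of [Z]. As [Y] is below [T],
    so is [Z]. If [P] is the product above [X] and [Y], then [Z P] contains
    [Z Y], hence [k]; so [Z P] and with it [Z X] are below [T]. Finally [X] is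
    below [W Z X], hence below [W T], which [T] absorbs because [W] is a left
    inverse of [Z]. *)
Lemma greatest_zeta T X Y :
  greatest_atom_product T -> zeta R X Y -> Y `<=` T -> X `<=` T.
Proof.
move=> gT /zetaP[aX aY [P [pP XP YP]]] YT.
have [_ [Z [_ aZ [_ [_ kZY]]]]] := wR aY.
have [_ [W [_ aW [_ [_ kWZ]]]]] := wR aZ.
have ZT : Z `<=` T := greatest_factorl gT aZ kZY YT.
apply: subset_trans (greatest_mull gT aW kWZ ZT).
have XWZX : X `<=` mul_subspace W (mul_subspace Z X).
  by rewrite mul_subA; apply: sub_mull => //; apply/subR/atomR.
apply: (subset_trans XWZX); apply: mul_mono => //.
have ZXP : mul_subspace Z X `<=` mul_subspace Z P by apply: mul_mono.
apply: (subset_trans ZXP).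
case: gT => _ _; apply; first exact: atom_productM (atom_product1 aZ) pP.
by apply: (subset_trans kZY); apply: mul_mono.
Qed.

(** One inclusion holds for every product of atoms that contains [k]; for the
    other, follow a chain of [zeta] steps down from [k]. *)
Lemma focal_greatest : greatest_atom_product (focal R).
Proof.
have [T gT] := greatest_atom_product_exists; have [pT kT _] := gT.
suff -> : focal R = T by [].
apply/seteqP; split; last exact: atom_product_sub_focal.
have chain X Y : zeta_star R X Y -> Y `<=` T -> X `<=` T.
  elim=> {X Y} [X Y zXY|X Y Z _ IHX _ IHY ZT]; last exact/IHX/IHY.
  exact: greatest_zeta zXY.
apply: sum_sub => [|X fX]; first exact/subR/atom_productR.
exact: chain fX kT.
Qed.

(** The focal subspace is itself a product of atoms, and it contains both [X]
    and [k]. *)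
Lemma focus_of_atom X : atoms R X -> X `<=` focal R -> focus R X.
Proof.
move=> aX XF; have [pF kF _] := focal_greatest.
by apply: t_step; apply/zetaP; split; [| exact: k1_atom | exists (focal R)].
Qed.

End Focus.

(** * Intervals below a subalgebra *)

Section Below.
Variables (k : fieldType) (A : algType k) (R : set (set A)) (B : set A).
Hypothesis (hR : atomistic_subsemiring R).
Implicit Types (E F G X Y Z : set A).

Lemma atoms_below X : atoms (below R B) X <-> atoms R X /\ X `<=` B.
Proof.
split.
- move=> [[RX XB] Xn0 minX]; do 2!split=> //.
  by move=> E RE EX; apply: minX => //; split=> //; apply: subset_trans XB.
- move=> [[RX Xn0 minX] XB]; split=> //.
  by move=> E [RE _]; apply: minX.
Qed.

Lemma circ_below X Y Z :
  circ (below R B) X Y Z <-> circ R X Y Z /\ Z `<=` B.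
Proof.
rewrite /circ /=; split=> [[/atoms_below[aZ ZB] ZXY]|[[aZ ZXY] ZB]].
  by split.
by split=> //; apply/atoms_below.
Qed.

Lemma below_atomistic : R B -> k1 A `<=` B -> mul_subspace B B `<=` B ->
  atomistic_subsemiring (below R B).
Proof.
move=> RB kB BB; have sB := assr_subspace hR RB; split.
- by move=> E [/(assr_subspace hR)].
- by split; [exact: assr_zero hR | exact: sub0_subspace].
- by split=> //; exact: assr_one hR.
- move=> S SRB; split; first by apply: (assr_sum hR) => E /SRB[].
  by apply: sum_sub => // E /SRB[].
- move=> S SRB [E SE]; split.
    by apply: (assr_cap hR); [move=> F /SRB[] | exists E].
  by apply: subset_trans (bigcap_inf SE) _; case: (SRB _ SE).
- move=> E F [RE EB] [RF FB]; split; first exact: assr_mul.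
  exact: subset_trans (mul_mono EB FB) BB.
- move=> E [RE EB] En0; have [S SR defE] := assr_atomistic hR RE En0.
  exists S => // X SX; apply/atoms_below; split; first exact: SR.
  by apply: subset_trans EB; rewrite defE; apply: sum_sup.
Qed.

Lemma below_entire : entire R -> entire (below R B).
Proof. by move=> hE E F [RE _] [RF _]; apply: hE. Qed.

Lemma below_finite_length : finite_length R -> finite_length (below R B).
Proof.
by move=> [n len]; exists n => C CR; apply: len => E /CR[].
Qed.

End Below.

Section BelowFocal.
Variables (k : fieldType) (A : algType k) (R : set (set A)).
Hypotheses (hR : atomistic_subsemiring R) (hE : entire R).
Hypothesis (lenR : finite_length R).
Implicit Types (X Y Z : set A).

Lemma reproducible_weakly : reproducible R -> weakly_reproducible R.
Proof.
move=> rR X aX; have [QX XQ] := rR X aX.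
have := k1_atom hR; rewrite -{1}QX => -[Z aZ [_ -> kZX]].
have := k1_atom hR; rewrite -{1}XQ => -[_ -> [Y aY kXY]].
by exists Y, Z.
Qed.

(** The inverses that [R] provides for an atom of the focus are absorbed. *)
Lemma below_focal_weakly_reproducible :
  weakly_reproducible R -> weakly_reproducible (below R (focal R)).
Proof.
move=> wR X /atoms_below[aX XF]; have gF := focal_greatest hR wR lenR.
have kF := k1_sub_focal hR.
have [Y [Z [aY aZ [kXY kZX]]]] := wR X aX.
have YF := greatest_factorr hR gF aY kXY.2 XF.
have ZF := greatest_factorl hR gF aZ kZX.2 XF.
exists Y, Z; split; try exact/atoms_below.
by split; apply/circ_below.
Qed.

(** A solution [Y] of [W <= Y X] is sought in the focal subspace. With [V] a
    right inverse of [W], the product [Y (X V)] contains [W V], hence [k], and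
    [X V] is below the focal subspace; so every solution in [R] is absorbed.
    The other side is symmetric. *)
Lemma below_focal_reproducible :
  reproducible R -> reproducible (below R (focal R)).
Proof.
move=> rR X aX'; have [aX XF] := (atoms_below _ _ _).1 aX'.
have wR := reproducible_weakly rR; have gF := focal_greatest hR wR lenR.
have FF := focal_mul hR hE.
have [QX XQ] := rR X aX; split; apply/seteqP; split.
- by move=> W [Y aY [_ -> []]].
- move=> W aW'; have [aW WF] := (atoms_below _ _ _).1 aW'.
  have := aW; rewrite -{1}QX => -[Y aY [_ -> [_ WYX]]].
  have [V [_ [aV _ [[_ kWV] _]]]] := wR W aW.
  have VF := greatest_factorr hR gF aV kWV WF.
  have kYXV : k1 A `<=` mul_subspace Y (mul_subspace X V).
    by rewrite mul_subA; apply: (subset_trans kWV); apply: mul_mono.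
  have YF : Y `<=` focal R.
    apply: (greatest_factorl hR gF aY kYXV).
    exact: subset_trans (mul_mono XF VF) FF.
  by exists Y; [apply/atoms_below | exists X].
- by move=> W [_ -> [Y aY []]].
- move=> W aW'; have [aW WF] := (atoms_below _ _ _).1 aW'.
  have := aW; rewrite -{1}XQ => -[_ -> [Y aY [_ WXY]]].
  have [_ [V [_ aV [_ [_ kVW]]]]] := wR W aW.
  have VF := greatest_factorl hR gF aV kVW WF.
  have kVXY : k1 A `<=` mul_subspace (mul_subspace V X) Y.
    by rewrite -mul_subA; apply: (subset_trans kVW); apply: mul_mono.
  have YF : Y `<=` focal R.
    apply: (greatest_factorr hR gF aY kVXY).
    exact: subset_trans (mul_mono VF XF) FF.
  by exists X => //; exists Y; [apply/atoms_below | split].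
Qed.

End BelowFocal.

(** * Pulling back along an injective algebra morphism *)

Section Pullback.
Variables (k : fieldType) (A B : algType k) (f : B -> A).
Hypotheses (f_inj : injective f) (f_lin : linear f) (f_1 : f 1 = 1).
Hypothesis (fM : {morph f : x y / x * y}).
Variable R : set (set A).
Hypothesis (R_range : forall E, R E -> E `<=` range f).
Implicit Types (E F : set A) (G H : set B).

(** For the inclusion of a subalgebra this is the family of members of [R] seen
    as subsets of the subalgebra. Describing it by direct images makes every
    operation on [B] correspond to the same operation on [A]. *)
Definition pullback : set (set B) := [set G | R (f @` G)].

Lemma linear_image0 : f 0 = 0.
Proof. by have := f_lin (-1) 0 0; rewrite scaler0 addr0 scaleN1r addNr. Qed.

Lemma image_subE G H : f @` G `<=` f @` H <-> G `<=` H.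
Proof.
split=> [fGH x Gx|]; last exact: image_subset.
by have /fGH : (f @` G) (f x) by []; rewrite image_inj.
Qed.

Lemma image_set_inj : injective (fun G => f @` G).
Proof. by move=> G H /seteqP[/image_subE GH /image_subE HG]; apply/seteqP. Qed.

(** All members of [R] being below the range of [f], direct image is an
    isomorphism of ordered sets from the pullback onto [R]. *)
Lemma imageE E : R E -> f @` (f @^-1` E) = E.
Proof.
move=> RE; apply/seteqP; split=> [_ [x Ex <-] //|y Ey].
by have [x _ def_y] := R_range RE Ey; exists x; rewrite //= def_y.
Qed.

Lemma image_subspace G : is_subspace (f @` G) <-> is_subspace G.
Proof.
split=> /is_subspaceP[G0 Glin]; apply/is_subspaceP; split.
- by move: G0; rewrite -linear_image0 image_inj.
- move=> a u v Gu Gv; rewrite -(image_inj f_inj) f_lin.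
  by apply: Glin; rewrite image_inj.
- by exists 0 => //; apply: linear_image0.
- move=> a _ _ [u Gu <-] [v Gv <-]; rewrite -f_lin.
  by exists (a *: u + v) => //; apply: Glin.
Qed.

Lemma image_span G : f @` span G = span (f @` G).
Proof.
have sfG : is_subspace (f @` span G).
  by apply/image_subspace; apply: span_subspace.
apply/seteqP; split; last first.
  by apply: (span_sub sfG); exact: image_subset (@sub_span _ _ G).
move=> _ [x + <-]; move: x.
apply: (@span_sub _ _ _ (f @^-1` span (f @` G))) => [|x Gx]; last first.
  by apply: sub_span; exists x.
apply/is_subspaceP; split=> [|a u v fu fv] /=.
  by rewrite linear_image0; exact: subspace0 (span_subspace _).
by rewrite f_lin; exact: subspace_lin (span_subspace _) fu fv.
Qed.

Lemma image_sum (S : set (set B)) :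
  f @` sum_family S = sum_family [set f @` G | G in S].
Proof. by rewrite /sum_family image_span image_bigcup bigcup_image. Qed.

Lemma image_mul G H :
  f @` mul_subspace G H = mul_subspace (f @` G) (f @` H).
Proof.
rewrite /mul_subspace image_span; congr (span _); apply/seteqP; split.
- move=> _ [_ [x [y [Gx Hy ->]]] <-].
  by exists (f x), (f y); split; [exists x | exists y | exact: fM].
- move=> _ [_ [_ [[x Gx <-] [y Hy <-] ->]]].
  by exists (x * y); [exists x, y | exact: fM].
Qed.

Lemma image_0 : f @` [set 0] = [set 0].
Proof. by rewrite image_set1 linear_image0. Qed.

Lemma image_k1 : f @` k1 B = k1 A.
Proof.
have fc (c : k) : f c%:A = c%:A.
  by have := f_lin c 1 0; rewrite linear_image0 !addr0 f_1.
apply/seteqP; split; first by move=> _ [_ [c _ <-] <-]; exists c.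
by move=> _ [c _ <-]; exists c%:A => //; exists c.
Qed.

Lemma image_neq0 G : f @` G <> [set 0] <-> G <> [set 0].
Proof.
split=> Gn0 G0; apply: Gn0; first by rewrite G0 image_0.
by apply: image_set_inj; rewrite image_0.
Qed.

(** [S] is nonempty because the image of the empty intersection is the range of
    [f], which may differ from [A]. *)
Lemma image_cap (S : set (set B)) : S !=set0 ->
  f @` (\bigcap_(G in S) G) = \bigcap_(E in [set f @` G | G in S]) E.
Proof.
move=> [G0 SG0]; rewrite bigcap_image; apply/seteqP; split.
  by move=> _ [x Gx <-] G SG; exists x => //; apply: Gx.
move=> y fy; have [x _ def_y] := fy _ SG0; exists x => // G SG.
by rewrite -(image_inj f_inj) def_y; apply: fy.
Qed.

Lemma atoms_pullback G : atoms pullback G <-> atoms R (f @` G).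
Proof.
split=> -[RG Gn0 minG]; split=> //; try exact/image_neq0.
- move=> E RE; rewrite -{1 2 3}(imageE RE) => /image_subE EG /image_neq0 En0.
  by rewrite -(imageE RE) (minG _ _ EG En0) // /pullback /= imageE.
- move=> H RH HG Hn0; apply: image_set_inj.
  by apply: minG => //; [apply/image_subE | apply/image_neq0].
Qed.

Lemma circ_pullback G H K :
  circ pullback G H K <-> circ R (f @` G) (f @` H) (f @` K).
Proof.
rewrite /circ /= -image_mul.
by split=> -[/atoms_pullback aK /image_subE KGH]; split.
Qed.

Lemma pullback_atomistic :
  atomistic_subsemiring R -> atomistic_subsemiring pullback.
Proof.
move=> hR; split; rewrite /pullback /=.
- by move=> G /(assr_subspace hR)/image_subspace.
- by rewrite image_0; exact: assr_zero hR.
- by rewrite image_k1; exact: assr_one hR.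
- move=> S SR; rewrite image_sum; apply: (assr_sum hR).
  by move=> _ [G SG <-]; apply: SR.
- move=> S SR S0; rewrite image_cap //; apply: (assr_cap hR).
    by move=> _ [G SG <-]; apply: SR.
  by case: S0 => G SG; exists (f @` G), G.
- by move=> G H RG RH; rewrite image_mul; apply: (assr_mul hR).
- move=> G RG /image_neq0 Gn0; have [S SR defG] := assr_atomistic hR RG Gn0.
  exists [set H | S (f @` H)] => [H /SR/atoms_pullback //|].
  apply: image_set_inj; rewrite image_sum defG; congr sum_family.
  apply/seteqP; split=> [E SE|_ [H SH <-] //].
  have [RE _ _] := SR _ SE.
  by exists (f @^-1` E); rewrite /= imageE.
Qed.

Lemma pullback_entire : entire R -> entire pullback.
Proof.
move=> hE G H RG RH GH0; case: (hE _ _ RG RH).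
- by rewrite -image_mul GH0 image_0.
- by rewrite -image_0 => /image_set_inj; left.
- by rewrite -image_0 => /image_set_inj; right.
Qed.

Lemma pullback_finite_length : finite_length R -> finite_length pullback.
Proof.
move=> [n len]; exists n => C CR Ctot.
have fC : [set f @` G | G in C] #= C.
  by apply: inj_card_eq => G H _ _; apply: image_set_inj.
rewrite -(card_le_eql fC); apply: len; first by move=> _ [G CG <-]; apply: CR.
move=> _ _ [G CG <-] [H CH <-].
by case: (Ctot G H CG CH) => /image_subE; [left | right].
Qed.

Lemma pullback_atom_lift E : atoms R E -> atoms pullback (f @^-1` E).
Proof. by move=> aE; apply/atoms_pullback; rewrite imageE //; case: aE. Qed.

Lemma pullback_weakly_reproducible :
  weakly_reproducible R -> weakly_reproducible pullback.
Proof.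
move=> wR G /atoms_pullback aG; have [Y [Z [aY aZ [kGY kZG]]]] := wR _ aG.
have [RY RZ] : R Y /\ R Z by case: aY; case: aZ.
exists (f @^-1` Y), (f @^-1` Z); split; try exact: pullback_atom_lift.
by split; apply/circ_pullback; rewrite imageE // image_k1.
Qed.

Lemma pullback_reproducible : reproducible R -> reproducible pullback.
Proof.
move=> rR G /atoms_pullback aG; have [QG GQ] := rR _ aG.
split; apply/seteqP; split.
- by move=> W [Y aY [_ -> []]].
- move=> W /atoms_pullback; rewrite -{1}QG => -[Y aY [_ -> cW]].
  exists (f @^-1` Y); first exact: pullback_atom_lift.
  by exists G => //; apply/circ_pullback; rewrite imageE //; case: aY.
- by move=> W [_ -> [Y aY []]].
- move=> W /atoms_pullback; rewrite -{1}GQ => -[_ -> [Y aY cW]].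
  exists G => //; exists (f @^-1` Y); first exact: pullback_atom_lift.
  by apply/circ_pullback; rewrite imageE //; case: aY.
Qed.

End Pullback.

Lemma subalgebra_val_range (k : fieldType) (A : algType k) (B : set A)
    (hB : is_unital_subalgebra B) : range (val : subalgebra hB -> A) = B.
Proof.
apply/seteqP; split=> [_ [x _ <-]|x Bx]; first exact/set_mem/(valP x).
by exists (Subalgebra hB (mem_set Bx)).
Qed.

Lemma restrict_to_pullback (k : fieldType) (A : algType k) (B : set A)
    (hB : is_unital_subalgebra B) (R : set (set A)) :
  (forall E, R E -> E `<=` B) ->
  restrict_to hB R = pullback (val : subalgebra hB -> A) R.
Proof.
move=> RB; have R_range E : R E -> E `<=` range (val : subalgebra hB -> A).
  by rewrite subalgebra_val_range; apply: RB.
apply/seteqP; split=> [_ [E RE <-]|G RG].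
  by rewrite /pullback /= (imageE R_range).
exists (val @` G) => //; apply: (image_set_inj val_inj).
exact: (imageE R_range).
Qed.

Theorem theorem4p3 (k : fieldType) (A : algType k) (R : set (set A))
    (hR : atomistic_subsemiring R) (hE : entire R) :
  exists hF : is_unital_subalgebra (focal R),
    let RF := restrict_to hF (below R (focal R)) in
    [/\ [/\ atomistic_subsemiring RF, entire RF &
            focus R `<=` atoms (below R (focal R))],
        (weakly_reproducible R -> finite_length R ->
           atoms (below R (focal R)) = focus R),
        (weakly_reproducible R -> finite_length R ->
           weakly_reproducible RF /\ finite_length RF) &
        (reproducible R -> finite_length R ->
           reproducible RF /\ finite_length RF)].
Proof.
have RF := focalR hR; have kF := k1_sub_focal hR; have FF := focal_mul hR hE.
have hF := unital_subalgebra_of_mul (assr_subspace hR RF) kF FF.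
exists hF; rewrite /= restrict_to_pullback; last by move=> E [].
set f := (X in pullback X _).
have f_inj : injective f := val_inj.
have f_lin : linear f by move=> a x y; apply: subalgebra_valP.
have f_1 : f 1 = 1 := subalgebra_val1 hF.
have fM : {morph f : x y / x * y} := @subalgebra_valM _ _ _ hF.
have R_range E : below R (focal R) E -> E `<=` range f.
  by rewrite subalgebra_val_range => -[].
split.
- split.
  + by apply: pullback_atomistic => //; apply: below_atomistic.
  + by apply: pullback_entire => //; apply: below_entire.
  + move=> X fX; apply/atoms_below; split; first exact: focus_atom fX.
    exact: focus_sub_focal.
- move=> wR lR; apply/seteqP; split=> X.
    by move=> /atoms_below[aX XF]; apply: focus_of_atom.
  move=> fX; apply/atoms_below; split; first exact: focus_atom fX.
  exact: focus_sub_focal.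
- move=> wR lR; split.
    apply: pullback_weakly_reproducible => //.
    exact: below_focal_weakly_reproducible.
  by apply: pullback_finite_length => //; apply: below_finite_length.
- move=> rR lR; split.
    by apply: pullback_reproducible => //; apply: below_focal_reproducible.
  by apply: pullback_finite_length => //; apply: below_finite_length.
Qed.
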